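(* Let $\mathbb U,\mathbb V$ be nontrivial real Hilbert spaces, let $b:\mathbb U\times\mathbb V\to\mathbb R$ be a bilinear form satisfying the continuity, injectivity and surjectivity conditions given in the context, let $\ell:\mathbb V\to\mathbb R$ be a continuous linear functional, and let $u^*\in\mathbb U$ be the unique element with $b(u^*,v)=\ell(v)$ for all $v\in\mathbb V$. Let $B,B'$ be the operators associated with $b$ (see context). Let $\rho>0$, $\varepsilon>0$, $u^0\in\mathbb U$, and let $\{u^k\}_{k\ge0}\subset\mathbb U$, $\{r^k\},\{r^k_\varepsilon\}\subset\mathbb V$, $\{\delta^k\},\{\delta^k_\varepsilon\}\subset\mathbb U$ satisfy, for all $k\ge0$, $$r^k=\arg\min_{r\in\mathbb V}\ \tfrac12\|r\|_{\mathbb V}^2-\ell(r)+b(u^k,r),$$ $$\delta^k=\arg\min_{\delta\in\mathbb U}\ \tfrac12\|\delta\|_{\mathbb U}^2-b(\delta,r^k_\varepsilon),$$ $$u^{k+1}=u^0+\rho\delta^0_\varepsilon+\rho\delta^1_\varepsilon+\cdots+\rho\delta^k_\varepsilon,$$ together with the relative error bounds $$\|r^k_\varepsilon-r^k\|_{\mathbb V}\le\varepsilon\|r^k\|_{\mathbb V},\qquad \|\delta^k_\varepsilon-\delta^k\|_{\mathbb U}\le\varepsilon\|\delta^k\|_{\mathbb U}.$$ If $\rho<2\|B\|^{-2}$ and $$\varepsilon^2+2\varepsilon<\frac{1-\|I-\rho B'B\|}{\rho\|B\|^2},$$ then $r^k_\varepsilon\to0$ in $\mathbb V$, $\delta^k_\varepsilon\to0$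 in $\mathbb U$, and $u^k\to u^*$ in $\mathbb U$ as $k\to\infty$.
   Context: $\mathbb U$ and $\mathbb V$ carry inner products $(\cdot,\cdot)_{\mathbb U}$, $(\cdot,\cdot)_{\mathbb V}$ with induced norms $\|\cdot\|_{\mathbb U}$, $\|\cdot\|_{\mathbb V}$; $\|\cdot\|$ on operators is the operator norm and $I$ is the identity on $\mathbb U$. Conditions on $b$: - Continuity: there is $M>0$ with $\sup_{v\in\mathbb V\setminus\{0\}}\frac{|b(u,v)|}{\|v\|_{\mathbb V}}\le M\|u\|_{\mathbb U}$ for all $u\in\mathbb U$. - Injectivity: there is $\gamma_1>0$ with $\sup_{v\in\mathbb V\setminus\{0\}}\frac{|b(u,v)|}{\|v\|_{\mathbb V}}\ge\gamma_1\|u\|_{\mathbb U}$ for all $u\in\mathbb U$. - Surjectivity: there is $\gamma_2>0$ with $\sup_{u\in\mathbb U\setminus\{0\}}\frac{|b(u,v)|}{\|u\|_{\mathbb U}}\ge\gamma_2\|v\|_{\mathbb V}$ for all $v\in\mathbb V$. Under these conditions the problem defining $u^*$ has a unique solution. The bounded operators $B:\mathbb U\to\mathbb V$ and $B':\mathbb V\to\mathbb U$ are defined by $(Bu,v)_{\mathbb V}=b(u,v)=(u,B'v)_{\mathbb U}$ for all $u\in\mathbb U$, $v\in\mathbb V$. The elements $r^k_\varepsilon$, $\delta^k_\varepsilon$ are inexact versions (quasi-minimizers) of $r^k$, $\delta^k$; the only requirement on them is the relative error bounds in the claim. *)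

(* Defs.v *)
From HB Require Import structures.
From mathcomp Require Import all_boot all_order all_algebra.
From mathcomp Require Import all_classical all_reals all_analysis.

Set Implicit Arguments.
Unset Strict Implicit.
Unset Printing Implicit Defensive.

Import Order.TTheory GRing.Theory Num.Theory.
Import numFieldNormedType.Exports.

Local Open Scope classical_set_scope.
Local Open Scope ring_scope.

(* A real Hilbert space is a completeNormedModType whose norm is induced by a
   positive definite symmetric bilinear form (a {dot U for idfun}). *)
Definition induces_norm (R : realType) (U : normedModType R)
    (dot : {dot U for idfun}) : Prop :=
  forall x : U, `|x| = Num.sqrt (dot x x).

(* Extended-real valued, so that no boundedness of f is presupposed. *)
Definition sup_quotient (R : realType) (X Y : normedZmodType R) (f : X -> Y) :
    \bar R :=
  ereal_sup [set (`|f x| / `|x|)%:E | x in [set x : X | x != 0]].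

(* Meaningful for bounded linear f; an unbounded f gets the value fine +oo = 0. *)
Definition opnorm (R : realType) (X Y : normedZmodType R) (f : X -> Y) : R :=
  fine (sup_quotient f).

Section Form.
Context {R : realType} {U V : normedModType R}.
Implicit Type b : {bilinear U -> V -> R | *%R & *%R}.

Definition form_continuity b : Prop :=
  exists2 M : R, 0 < M &
    forall u : U, (sup_quotient (b u) <= (M * `|u|)%:E)%E.

Definition form_injectivity b : Prop :=
  exists2 gamma1 : R, 0 < gamma1 &
    forall u : U, (sup_quotient (b u) >= (gamma1 * `|u|)%:E)%E.

Definition form_surjectivity b : Prop :=
  exists2 gamma2 : R, 0 < gamma2 &
    forall v : V, (sup_quotient (fun u : U => b u v) >= (gamma2 * `|v|)%:E)%E.

End Form.

Definition is_argmin (R : realType) (T : Type) (J : T -> R) (x : T) : Prop :=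
  forall y : T, J x <= J y.

(* Main.v *)
(** Write [e k = u k - ustar]. The minimality conditions say exactly that
    [r k = - B (e k)] and [delta k = B' (reps k)], so one step of the scheme is
      [e k.+1 = (I - rho B'B) (e k) + rho B' (reps k - r k)
                + rho (deltaeps k - delta k)].
    As [|B'| <= |B|], both perturbations are bounded by multiples of
    [rho |B|^2 |e k|] and [|e k.+1| <= q |e k|] with
    [q = |I - rho B'B| + rho |B|^2 (eps^2 + 2 eps) < 1]. *)
Require Import Defs.
From HB Require Import structures.
From mathcomp Require Import all_boot all_order all_algebra.
From mathcomp Require Import all_classical all_reals all_analysis.
From mathcomp Require Import ring lra.
Import Order.TTheory GRing.Theory Num.Theory.
Import numFieldNormedType.Exports.
Local Open Scope classical_set_scope.
Local Open Scope ring_scope.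

Set Implicit Arguments.
Unset Strict Implicit.

Section DotNorm.
Context (R : realType) (U : normedModType R) (dot : {dot U for idfun}).
Hypothesis normU : induces_norm dot.

Lemma dot_sym x y : dot x y = dot y x.
Proof. by rewrite hermC expr0 mul1r. Qed.

Lemma dot_sqr_norm x : dot x x = `|x| ^+ 2.
Proof.
rewrite normU sqr_sqrtr//.
have [->|x0] := eqVneq x 0; first by rewrite linear0r.
exact/ltW/neq0_dnorm_gt0.
Qed.

Lemma sqr_normD x y : `|x + y| ^+ 2 = `|x| ^+ 2 + 2 * dot x y + `|y| ^+ 2.
Proof.
by rewrite -!dot_sqr_norm linearDl !linearDr /= (dot_sym y x); ring.
Qed.

(* Squaring the triangle inequality, which [U] has as a normed module. *)
Lemma dot_le_norm x y : dot x y <= `|x| * `|y|.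
Proof.
have : `|x + y| ^+ 2 <= (`|x| + `|y|) ^+ 2.
  by rewrite ler_sqr ?nnegrE ?addr_ge0// ler_normD.
by rewrite sqr_normD; nra.
Qed.

(* Up to a constant, [J s] is [2^-1 * `|s - w| ^+ 2]. *)
Lemma dot_argmin (J : U -> R) w x :
  (forall s, J s = 2^-1 * `|s| ^+ 2 - dot w s) -> is_argmin J x -> x = w.
Proof.
move=> JE /(_ w); rewrite !JE dot_sqr_norm => Jxw.
apply/eqP; rewrite eq_sym -subr_eq0 -normr_eq0 -sqrf_eq0 eq_le sqr_ge0 andbT.
by rewrite sqr_normD linearNr normrN; lra.
Qed.

End DotNorm.

Lemma sup_quotient_le (R : realType) (X Y : normedZmodType R) (f : X -> Y) C :
  (sup_quotient f <= C%:E)%E -> forall x, x != 0 -> `|f x| <= C * `|x|.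
Proof.
move=> fC x x0; rewrite -ler_pdivrMr ?normr_gt0// -lee_fin.
by apply: le_trans fC; apply: ereal_sup_ubound; exists x.
Qed.

Section Opnorm.
Context (R : realType) (X Y : normedZmodType R) (f : X -> Y) (C : R).
Hypotheses (X0 : exists x : X, x != 0) (fC : forall x, `|f x| <= C * `|x|).

(** The nonzero point given by [X0] matters: over an empty index set the supremum would be [-oo]. *)
Let sup_ge0 : (0 <= sup_quotient f)%E.
Proof.
have [x x0] := X0; apply: (@le_trans _ _ (`|f x| / `|x|)%:E).
  by rewrite lee_fin divr_ge0.
by apply: ereal_sup_ubound; exists x.
Qed.

Lemma opnorm_ge0 : 0 <= opnorm f.
Proof. exact: fine_ge0. Qed.

(** The bound [fC] keeps the supremum below [+oo], so [fine] returns it and not its default value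
    0. *)
Lemma opnorm_bound x : `|f x| <= opnorm f * `|x|.
Proof.
have [->|x0] := eqVneq x 0; first by have := fC 0; rewrite normr0 !mulr0.
apply: sup_quotient_le x0; rewrite /opnorm fineK//.
rewrite ge0_fin_numE//; apply: (@le_lt_trans _ _ C%:E); last exact: ltry.
apply: ge_ereal_sup => _ [y y0 <-].
by rewrite lee_fin ler_pdivrMr ?normr_gt0.
Qed.

End Opnorm.

Lemma geometric_bound_cvg0 (R : realType) (W : normedModType R) (f : nat -> W)
    (C q : R) :
  0 <= q -> q < 1 -> (forall k, `|f k| <= C * q ^+ k) -> f @ \oo --> (0 : W).
Proof.
move=> q0 q1 fC; apply: norm_cvg0.
apply: (@squeeze_cvgr _ _ _ _ (fun=> 0) (geometric C q)).
- by apply: nearW => k; rewrite normr_ge0 fC.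
- exact: cvg_cst.
- by apply: cvg_geometric; rewrite ger0_norm.
Qed.

Theorem theorem1 (R : realType) (U V : completeNormedModType R)
  (dotU : {dot U for idfun}) (dotV : {dot V for idfun})
  (normU : induces_norm dotU) (normV : induces_norm dotV)
  (ntU : exists x : U, x != 0) (ntV : exists y : V, y != 0)
  (b : {bilinear U -> V -> R | *%R & *%R})
  (b_cont : form_continuity b)
  (b_inj : form_injectivity b)
  (b_surj : form_surjectivity b)
  (l : {linear V -> R | *%R}) (l_cont : continuous (l : V -> R))
  (ustar : U) (ustarP : forall v : V, b ustar v = l v)
  (B : {linear U -> V}) (B' : {linear V -> U})
  (BP : forall (x : U) (v : V), dotV (B x) v = b x v)
  (B'P : forall (x : U) (v : V), b x v = dotU x (B' v))
  (rho eps : R) (rho_gt0 : 0 < rho) (eps_gt0 : 0 < eps)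
  (u : nat -> U) (r reps : nat -> V) (delta deltaeps : nat -> U)
  (rP : forall k : nat,
    is_argmin (fun s : V => 2^-1 * `|s| ^+ 2 - l s + b (u k) s) (r k))
  (deltaP : forall k : nat,
    is_argmin (fun d : U => 2^-1 * `|d| ^+ 2 - b d (reps k)) (delta k))
  (uP : forall k : nat,
    u k.+1 = u 0%N + \sum_(j < k.+1) rho *: deltaeps j)
  (repsP : forall k : nat, `|reps k - r k| <= eps * `|r k|)
  (deltaepsP : forall k : nat,
    `|deltaeps k - delta k| <= eps * `|delta k|)
  (rho_lt : rho < 2 * opnorm B ^- 2)
  (eps_lt : eps ^+ 2 + 2 * eps <
    (1 - opnorm (fun x : U => x - rho *: B' (B x))) / (rho * opnorm B ^+ 2)) :
  [/\ reps @ \oo --> (0 : V),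
      deltaeps @ \oo --> (0 : U) &
      u @ \oo --> ustar].
Proof.
have [M M0 bM] := b_cont.
have Bbounded x : `|B x| <= M * `|x|.
  (* Continuity tested at [v = B x] gives [|B x| ^+ 2 = b x (B x) <= M * |x| * |B x|]; one factor
     [|B x|] cancels. *)
  have [->|Bx0] := eqVneq (B x) 0; first by rewrite normr0 mulr_ge0// ltW.
  have /= := sup_quotient_le (bM x) Bx0.
  rewrite -BP (dot_sqr_norm normV) ger0_norm ?sqr_ge0// expr2.
  by rewrite ler_pM2r ?normr_gt0.
set beta := opnorm B in rho_lt eps_lt.
have beta_ge0 : 0 <= beta := opnorm_ge0 B ntU.
have Bbeta x : `|B x| <= beta * `|x| := opnorm_bound ntU Bbounded x.
(* If [beta = 0] then [beta ^- 2 = 0], so [rho_lt] contradicts [0 < rho]. *)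
have beta_gt0 : 0 < beta.
  rewrite lt_def beta_ge0 andbT; apply: contraTneq rho_lt => ->.
  by rewrite expr0n/= invr0 mulr0 -leNgt ltW.
(* By Cauchy-Schwarz, [|B' v| ^+ 2 = b (B' v) v = dotV (B (B' v)) v <= beta * |B' v| * |v|]. *)
have B'beta v : `|B' v| <= beta * `|v|.
  have [->|B'v0] := eqVneq (B' v) 0; first by rewrite normr0 mulr_ge0.
  rewrite -(@ler_pM2r _ `|B' v|) ?normr_gt0// -expr2 -(dot_sqr_norm normU).
  rewrite -B'P -BP (le_trans (dot_le_norm normV _ _))//.
  by rewrite mulrAC ler_wpM2r.
set A := fun x : U => x - rho *: B' (B x) in eps_lt.
(* This crude constant only certifies that [opnorm A] is finite. *)
have Abounded x : `|A x| <= (1 + rho * beta ^+ 2) * `|x|.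
  rewrite (le_trans (ler_normB _ _))// normrZ gtr0_norm// mulrDl mul1r lerD2l.
  rewrite -mulrA ler_pM2l// (le_trans (B'beta _))// expr2 -mulrA ler_pM2l//.
set alpha := opnorm A in eps_lt.
have alpha_ge0 : 0 <= alpha := opnorm_ge0 A ntU.
have Aalpha x : `|A x| <= alpha * `|x| := opnorm_bound ntU Abounded x.
pose e k := u k - ustar.
(* By [ustarP], [l s - b (u k) s = - b (e k) s = dotV (- B (e k)) s]. *)
have rE k : r k = - B (e k).
  apply: (dot_argmin normV _ (rP k)) => s.
  by rewrite linearNl /= BP /e linearBl ustarP; ring.
have deltaE k : delta k = B' (reps k).
  by apply: (dot_argmin normU _ (deltaP k)) => d; rewrite (dot_sym dotU) B'P.
have eS k : e k.+1 = A (e k) + rho *: B' (reps k - r k)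
                     + rho *: (deltaeps k - delta k).
  have uS : u k.+1 = u k + rho *: deltaeps k.
    rewrite uP big_ord_recr /= addrA; congr (_ + _).
    (* [uP] does not cover index 0, where the sum is empty. *)
    by case: k => [|k]; rewrite ?big_ord0 ?addr0// uP.
  have -> : e k.+1 = e k + rho *: deltaeps k by rewrite /e uS addrAC.
  (* Since [- r k = B (e k)], the term [rho *: B' (- r k)] cancels the [- rho *: B' (B (e k))] in
     [A (e k)]. *)
  rewrite deltaE rE opprK linearD/= /A scalerDr scalerBr.
  rewrite [rho *: B' (reps k) + _]addrC 2!addrA subrK.
  by rewrite [RHS]addrAC addrK.
have r_le k : `|r k| <= beta * `|e k| by rewrite rE normrN.
(* Each passage from an exact to an inexact quantity costs a factor [1 + eps], each use of [B] or
   [B'] a factor [beta]. *)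
have reps_le k : `|reps k| <= (1 + eps) * beta * `|e k|.
  rewrite -[reps k](subrK (r k)) (le_trans (ler_normD _ _))//.
  have := repsP k; have := r_le k; nra.
have delta_le k : `|delta k| <= (1 + eps) * beta ^+ 2 * `|e k|.
  rewrite deltaE (le_trans (B'beta _))//.
  have := reps_le k; nra.
have deltaeps_le k : `|deltaeps k| <= (1 + eps) ^+ 2 * beta ^+ 2 * `|e k|.
  rewrite -[deltaeps k](subrK (delta k)) (le_trans (ler_normD _ _))//.
  have := deltaepsP k; have := delta_le k; nra.
pose q := alpha + rho * beta ^+ 2 * (eps ^+ 2 + 2 * eps).
have q_ge0 : 0 <= q.
  by rewrite addr_ge0// !mulr_ge0 ?addr_ge0 ?sqr_ge0 ?mulr_ge0 ?ltW.
have q_lt1 : q < 1.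
  (* This is [eps_lt] multiplied by [rho * beta ^+ 2 > 0]. *)
  move: eps_lt; rewrite ltr_pdivlMr ?mulr_gt0 ?exprn_gt0// /q; lra.
have e_le k : `|e k.+1| <= q * `|e k|.
  rewrite eS (le_trans (ler_normD _ _))// !normrZ gtr0_norm//.
  have B'r : `|B' (reps k - r k)| <= eps * beta ^+ 2 * `|e k|.
    rewrite (le_trans (B'beta _))//.
    have -> : eps * beta ^+ 2 * `|e k| = beta * (eps * (beta * `|e k|)) by ring.
    by rewrite ler_pM2l// (le_trans (repsP k))// ler_pM2l.
  (* Together with [B'r] the coefficients add up to [eps + eps * (1 + eps) = eps ^+ 2 + 2 * eps], as
     in [q]. *)
  have dd : `|deltaeps k - delta k| <= eps * (1 + eps) * beta ^+ 2 * `|e k|.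
    by rewrite (le_trans (deltaepsP k))// -2!mulrA ler_pM2l// mulrA.
  have := ler_normD (A (e k)) (rho *: B' (reps k - r k)).
  move: B'r dd.
  rewrite -(ler_pM2l rho_gt0) -[_ <= eps * _ * _ * _](ler_pM2l rho_gt0).
  by rewrite normrZ gtr0_norm// /q; have := Aalpha (e k); lra.
have e_geo k : `|e k| <= `|e 0%N| * q ^+ k.
  elim: k => [|k IH]; first by rewrite expr0 mulr1.
  by rewrite (le_trans (e_le k))// exprS mulrCA ler_wpM2l.
(* All three limits follow from domination by [|e k|]; [W] is general because [reps] lives in [V],
   the other sequences in [U]. *)
have cvg0 (W : normedModType R) (f : nat -> W) (C : R) :
    0 <= C -> (forall k, `|f k| <= C * `|e k|) -> f @ \oo --> (0 : W).
  move=> C0 fC; apply: (@geometric_bound_cvg0 _ _ _ (C * `|e 0%N|) q) => // k.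
  by rewrite (le_trans (fC k))// -mulrA ler_wpM2l.
split.
- by apply: cvg0 reps_le; rewrite mulr_ge0 ?addr_ge0 ?ltW.
- by apply: cvg0 deltaeps_le; rewrite mulr_ge0 ?sqr_ge0.
- apply/subr_cvg0.
  by apply: (cvg0 _ e 1) => // k; rewrite mul1r.
Qed.
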